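(* Every function $f:\mathbb{R}^n\to\mathbb{R}$ that is semi-algebraic, lower (resp. upper) semicontinuous and bounded on every compact set is the optimistic (resp. pessimistic) value function of a bilevel problem with polynomial upper- and lower-level objectives $P,Q$, with $Q(x,\cdot)$ convex for every $x$, and with lower-level feasible set a compact, convex, semi-algebraic set. In particular, $$\mathcal{C}^{\mathrm{optim}}_{\mathrm{cc}}=\mathcal{SA}\cap\mathcal{LSC}\cap\mathcal{CB},\qquad \mathcal{C}^{\mathrm{pessim}}_{\mathrm{cc}}=\mathcal{SA}\cap\mathcal{USC}\cap\mathcal{CB}.$$
   Context: For polynomials $P,Q:\mathbb{R}^n\times\mathbb{R}^m\to\mathbb{R}$ and $\mathcal{Y}\subseteq\mathbb{R}^m$: $\Theta(x):=\arg\min_{y\in\mathcal{Y}}Q(x,y)$; $\varphi_o(x)=\inf_{y\in\Theta(x)}P(x,y)$, $\varphi_p(x)=\sup_{y\in\Theta(x)}P(x,y)$, with $\varphi_o=+\infty$, $\varphi_p=-\infty$ when $\Theta(x)=\emptyset$. $\mathcal{C}^{\mathrm{optim}}_{\mathrm{cc}}$ (resp. $\mathcal{C}^{\mathrm{pessim}}_{\mathrm{cc}}$) is the set of functions $h$ on $\mathbb{R}^n$ for which there exist $m$, polynomials $P,Q$ with $Q(x,\cdot)$ convex for each $x$, and a compact, convex, semi-algebraic $\mathcal{Y}\subseteq\mathbb{R}^m$ with $\varphi_o=h$ (resp. $\varphi_p=h$). Semi-algebraic sets: finite unions of sets $\{P=0,\ Q_j>0,\ j\in J\}$ with polynomials $P,Q_j$;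 a function is semi-algebraic if its graph is. $\mathcal{SA}$: extended-real-valued semi-algebraic functions (the sets where $f$ is finite, $+\infty$, $-\infty$ are semi-algebraic and $f$ restricted to where it is finite is semi-algebraic). $\mathcal{LSC}$, $\mathcal{USC}$: lower/upper semicontinuous functions. $\mathcal{CB}$: real-valued functions bounded on every compact set. *)

(* Defs.v *)
From HB Require Import structures.
From mathcomp Require Import all_boot all_order all_algebra.
From mathcomp Require Import all_classical all_reals all_analysis.
(* The notations of mpoly clash with those of the analysis library. *)
From mathcomp Require mpoly.
Import (canonicals, coercions) mpoly.

Set Implicit Arguments.
Unset Strict Implicit.
Unset Printing Implicit Defensive.

Import Order.TTheory GRing.Theory Num.Theory numFieldNormedType.Exports.

Local Open Scope classical_set_scope.
Local Open Scope ring_scope.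

Definition peval (R : realType) (n : nat) (p : mpoly.mpoly n R) (x : 'rV[R]_n) : R :=
  mpoly.meval (x ord0) p.

(* A polynomial on R^n x R^m is a polynomial in n + m variables. *)
Definition peval2 (R : realType) (n m : nat) (p : mpoly.mpoly (n + m) R)
    (x : 'rV[R]_n) (y : 'rV[R]_m) : R :=
  peval p (row_mx x y).

Definition basic_semialgebraic (R : realType) (n : nat)
    (b : mpoly.mpoly n R * seq (mpoly.mpoly n R)) : set 'rV[R]_n :=
  [set x | peval b.1 x = 0 /\ forall q, q \in b.2 -> 0 < peval q x].

Definition semialgebraic (R : realType) (n : nat) (A : set 'rV[R]_n) : Prop :=
  exists s : seq (mpoly.mpoly n R * seq (mpoly.mpoly n R)),
    A = \big[setU/set0]_(b <- s) basic_semialgebraic b.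

(* R^n x R is identified with 'rV_(n + 1). *)
Definition graph (R : realType) (n : nat) (f : 'rV[R]_n -> R) : set 'rV[R]_(n + 1) :=
  [set z | f (lsubmx z) = rsubmx z ord0 ord0].

Definition semialgebraic_fun (R : realType) (n : nat) (f : 'rV[R]_n -> R) : Prop :=
  semialgebraic (graph f).

(* The graph of the restriction of h to the set where h is finite. *)
Definition finite_graph (R : realType) (n : nat) (h : 'rV[R]_n -> \bar R) :
    set 'rV[R]_(n + 1) :=
  [set z | h (lsubmx z) = (rsubmx z ord0 ord0)%:E].

Definition bounded_on_compacts (R : realType) (n : nat) (f : 'rV[R]_n -> R) : Prop :=
  forall K : set 'rV[R]_n, compact K -> [bounded f x | x in K].

Definition upper_semicontinuous (R : realType) (X : topologicalType)
    (f : X -> \bar R) : Prop :=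
  forall (x : X) (a : R), (f x < a%:E)%E ->
    exists2 V, nbhs x V & forall y, V y -> (f y < a%:E)%E.

Definition SA (R : realType) (n : nat) : set ('rV[R]_n -> \bar R) :=
  [set h | [/\ semialgebraic [set x | h x \is a fin_num],
               semialgebraic [set x | h x = +oo%E],
               semialgebraic [set x | h x = -oo%E] &
               semialgebraic (finite_graph h)]].

Definition LSC (R : realType) (n : nat) : set ('rV[R]_n -> \bar R) :=
  [set h | lower_semicontinuous h].

Definition USC (R : realType) (n : nat) : set ('rV[R]_n -> \bar R) :=
  [set h | upper_semicontinuous h].

Definition CB (R : realType) (n : nat) : set ('rV[R]_n -> \bar R) :=
  [set h | exists2 f : 'rV[R]_n -> R, h = EFin \o f & bounded_on_compacts f].

Definition Theta (R : realType) (n m : nat) (Q : mpoly.mpoly (n + m) R)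
    (Y : set 'rV[R]_m) (x : 'rV[R]_n) : set 'rV[R]_m :=
  [set y | Y y /\ forall y', Y y' -> peval2 Q x y <= peval2 Q x y'].

(* [ereal_inf set0 = +oo] and [ereal_sup set0 = -oo], as required where Theta
   is empty. *)
Definition optimistic_value (R : realType) (n m : nat)
    (P Q : mpoly.mpoly (n + m) R) (Y : set 'rV[R]_m) (x : 'rV[R]_n) : \bar R :=
  ereal_inf [set (peval2 P x y)%:E | y in Theta Q Y x].

Definition pessimistic_value (R : realType) (n m : nat)
    (P Q : mpoly.mpoly (n + m) R) (Y : set 'rV[R]_m) (x : 'rV[R]_n) : \bar R :=
  ereal_sup [set (peval2 P x y)%:E | y in Theta Q Y x].

(* Y is required to be nonempty: otherwise the constant functions +oo and -oo
   would be value functions, although they are not real-valued. *)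
Definition convex_compact_problem (R : realType) (n m : nat)
    (Q : mpoly.mpoly (n + m) R) (Y : set 'rV[R]_m) : Prop :=
  [/\ forall x : 'rV[R]_n, convex_function [set: 'rV[R]_m] (peval2 Q x),
      Y !=set0, compact Y, convex_set Y & semialgebraic Y].

Definition C_optim_cc (R : realType) (n : nat) : set ('rV[R]_n -> \bar R) :=
  [set h | exists (m : nat) (P Q : mpoly.mpoly (n + m) R) (Y : set 'rV[R]_m),
             convex_compact_problem Q Y /\ optimistic_value P Q Y = h].

Definition C_pessim_cc (R : realType) (n : nat) : set ('rV[R]_n -> \bar R) :=
  [set h | exists (m : nat) (P Q : mpoly.mpoly (n + m) R) (Y : set 'rV[R]_m),
             convex_compact_problem Q Y /\ pessimistic_value P Q Y = h].

Arguments SA : clear implicits.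
Arguments LSC : clear implicits.
Arguments USC : clear implicits.
Arguments CB : clear implicits.
Arguments C_optim_cc : clear implicits.
Arguments C_pessim_cc : clear implicits.

(* Main.v *)
(** Every lower semicontinuous semi-algebraic [f] bounded on compact sets has
    polynomial growth: by quantifier elimination, the truth value of "[|f| <= t]
    on the ball of squared radius [r]" is a boolean combination of signs of
    polynomials in [(r, t)], hence constant for [r] large and [t >= r ^ N].  So
    [F := f / (1 + |x|^2) ^ (K + 1)] is bounded.  Transport [F] to the unit sphere
    of [R ^ (n + 1)] by inverse stereographic projection [sigma], and let [Y] be
    the region between the lower convex envelope of [F] on the unit ball and a
    constant upper bound [C]; [Y] is compact, convex and, by quantifier
    elimination again, semi-algebraic.  Minimizing
    [Q (x, (s, t)) = - (1 + |x|^2) <sigma x, s>] over [Y] forces [s = sigma x].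
    Points of the sphere are exposed points of the ball, so by lower
    semicontinuity the envelope agrees with [F] there: the solution set is
    [{sigma x} x [F x, C]], and [P (x, (s, t)) = (1 + |x|^2) ^ (K + 1) t] has
    minimum [f x] on it.  Conversely, value functions are semi-algebraic by
    quantifier elimination, and lower semicontinuous by compactness of [Y].  The
    pessimistic case follows by changing the sign of [P]. *)

Require Import Defs.
From HB Require Import structures.
From mathcomp Require Import all_boot all_order all_algebra.
From mathcomp Require Import all_classical all_reals all_analysis.
From mathcomp Require Import lra ring.
From mathcomp Require mpoly qe_rcf.
From mathcomp Require Import ordered_qelim.

Import Order.TTheory GRing.Theory Num.Theory numFieldNormedType.Exports.
Import (canonicals, coercions) mpoly.

Set Implicit Arguments.
Unset Strict Implicit.
Unset Printing Implicit Defensive.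

Local Open Scope classical_set_scope.
Local Open Scope ring_scope.

(** * Polynomial functions and polynomial maps *)

Section Polynomials.
Variable R : realType.

Lemma pevalD n (p q : mpoly.mpoly n R) x : peval (p + q) x = peval p x + peval q x.
Proof. exact: mpoly.mevalD. Qed.

Lemma pevalM n (p q : mpoly.mpoly n R) x : peval (p * q) x = peval p x * peval q x.
Proof. exact: mpoly.mevalM. Qed.

Lemma pevalN n (p : mpoly.mpoly n R) x : peval (- p) x = - peval p x.
Proof. exact: mpoly.mevalN. Qed.

Lemma pevalC n c (x : 'rV[R]_n) : peval (mpoly.mpolyC n c) x = c.
Proof. exact: mpoly.mevalC. Qed.

Lemma peval_coord n i (x : 'rV[R]_n) :
  peval (mpoly.mpolyX R (mpoly.mnm1 i)) x = x ord0 i.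
Proof. exact: mpoly.mevalXU. Qed.

(** Products reach every monomial, sums then every polynomial. The points [u t] are indexed by an
    arbitrary type so that one induction serves substitution, translation into first-order terms,
    continuity, bounds and bivariate polynomials. *)
Lemma peval_closed (T : Type) (C : set (T -> R)) n (u : T -> 'rV[R]_n) :
  (forall c, C (fun=> c)) ->
  (forall f g, C f -> C g -> C (fun t => f t + g t)) ->
  (forall f g, C f -> C g -> C (fun t => f t * g t)) ->
  (forall i, C (fun t => u t ord0 i)) ->
  forall p, C (fun t => peval p (u t)).
Proof.
move=> Cc CD CM Cu; elim/mpoly.mpolyind => [|c m p _ _ Cp].
  rewrite (_ : (fun _ => _) = fun=> 0) //.
  by apply/funext => t; rewrite /peval mpoly.meval0.
rewrite (_ : (fun _ => _) =
  fun t => c * \prod_(i < n) u t ord0 i ^+ m i + peval p (u t)); last first.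
  by apply/funext => t; rewrite pevalD /peval mpoly.mevalZ mpoly.mevalX.
apply: (CD) => //; apply: (CM) => //.
elim: (index_enum _) => [|i s IHs].
  by under eq_fun do rewrite big_nil; exact: Cc.
under eq_fun do rewrite big_cons.
apply: (CM) => //; elim: (m i) => [|k IHk]; first exact: Cc.
by under eq_fun do rewrite exprS; exact: CM.
Qed.

(** Polynomiality as a property of functions: proofs can follow the shape of an expression without
    writing the polynomial down. *)
Definition polynomial_fun n (g : 'rV[R]_n -> R) :=
  exists p, forall v, g v = peval p v.

Lemma polynomial_peval n (p : mpoly.mpoly n R) : polynomial_fun (peval p).
Proof. by exists p. Qed.

Lemma polynomial_cst n c : @polynomial_fun n (fun=> c).
Proof. by exists (mpoly.mpolyC n c) => v; rewrite pevalC. Qed.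

Lemma polynomialD n (f g : 'rV[R]_n -> R) :
  polynomial_fun f -> polynomial_fun g -> polynomial_fun (fun v => f v + g v).
Proof. by move=> [p fp] [q gq]; exists (p + q) => v; rewrite pevalD fp gq. Qed.

Lemma polynomialM n (f g : 'rV[R]_n -> R) :
  polynomial_fun f -> polynomial_fun g -> polynomial_fun (fun v => f v * g v).
Proof. by move=> [p fp] [q gq]; exists (p * q) => v; rewrite pevalM fp gq. Qed.

Lemma polynomialN n (f : 'rV[R]_n -> R) :
  polynomial_fun f -> polynomial_fun (fun v => - f v).
Proof. by move=> [p fp]; exists (- p) => v; rewrite pevalN fp. Qed.

Lemma polynomialX n (f : 'rV[R]_n -> R) k :
  polynomial_fun f -> polynomial_fun (fun v => f v ^+ k).
Proof.
move=> pf; elim: k => [|k IHk]; first exact: polynomial_cst.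
by under eq_fun do rewrite exprS; exact: polynomialM.
Qed.

Lemma polynomial_sum n (I : finType) (f : I -> 'rV[R]_n -> R) :
  (forall i, polynomial_fun (f i)) -> polynomial_fun (fun v => \sum_i f i v).
Proof.
move=> pf; elim: (index_enum _) => [|i s IHs].
  by under eq_fun do rewrite big_nil; exact: polynomial_cst.
by under eq_fun do rewrite big_cons; exact: polynomialD.
Qed.

Definition polynomial_map n k (u : 'rV[R]_n -> 'rV[R]_k) :=
  forall i, polynomial_fun (fun v => u v ord0 i).

Lemma polynomial_comp n k (u : 'rV[R]_n -> 'rV[R]_k) p :
  polynomial_map u -> polynomial_fun (fun v => peval p (u v)).
Proof.
move=> pu; apply: (@peval_closed _ (@polynomial_fun n)) => //.
- exact: polynomial_cst.
- exact: polynomialD.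
- exact: polynomialM.
Qed.

Lemma polynomial_map_id n : polynomial_map (@id 'rV[R]_n).
Proof.
by move=> i; exists (mpoly.mpolyX R (mpoly.mnm1 i)) => v; rewrite peval_coord.
Qed.

Lemma polynomial_map_cst n k (a : 'rV[R]_k) :
  polynomial_map (fun _ : 'rV[R]_n => a).
Proof. by move=> i; exact: polynomial_cst. Qed.

Lemma polynomial_map_lsubmx n k l (u : 'rV[R]_n -> 'rV[R]_(k + l)) :
  polynomial_map u -> polynomial_map (fun v => lsubmx (u v)).
Proof. by move=> pu i; under eq_fun do rewrite mxE. Qed.

Lemma polynomial_map_rsubmx n k l (u : 'rV[R]_n -> 'rV[R]_(k + l)) :
  polynomial_map u -> polynomial_map (fun v => rsubmx (u v)).
Proof. by move=> pu i; under eq_fun do rewrite mxE. Qed.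

Lemma polynomial_map_row_mx n k l (u : 'rV[R]_n -> 'rV[R]_k)
    (w : 'rV[R]_n -> 'rV[R]_l) :
  polynomial_map u -> polynomial_map w ->
  polynomial_map (fun v => row_mx (u v) (w v)).
Proof.
by move=> pu pw i; under eq_fun do rewrite mxE; case: (fintype.split i).
Qed.

Lemma polynomial_map_scalar n (f : 'rV[R]_n -> R) :
  polynomial_fun f -> polynomial_map (fun v => (f v)%:M : 'rV[R]_1).
Proof.
move=> pf i; rewrite (ord1 i) (_ : (fun _ => _) = f) //.
by apply/funext => v; rewrite mxE eqxx mulr1n.
Qed.

Lemma polynomial_mapZ n k (f : 'rV[R]_n -> R) (u : 'rV[R]_n -> 'rV[R]_k) :
  polynomial_fun f -> polynomial_map u -> polynomial_map (fun v => f v *: u v).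
Proof. by move=> pf pu i; under eq_fun do rewrite mxE; exact: polynomialM. Qed.

Lemma polynomial_peval2 n k l (p : mpoly.mpoly (k + l) R)
    (u : 'rV[R]_n -> 'rV[R]_k) (w : 'rV[R]_n -> 'rV[R]_l) :
  polynomial_map u -> polynomial_map w ->
  polynomial_fun (fun v => peval2 p (u v) (w v)).
Proof. by move=> pu pw; apply/polynomial_comp/polynomial_map_row_mx. Qed.

End Polynomials.

(** * Boolean algebra of semi-algebraic sets *)

Section Semialgebraic.
Variable R : realType.

Lemma semialgebraicP n (A : set 'rV[R]_n) :
  semialgebraic A <->
  exists s : seq (mpoly.mpoly n R * seq (mpoly.mpoly n R)), forall x,
    A x <-> exists2 b, b \in s & basic_semialgebraic b x.
Proof.
have mem_bigU (s : seq (mpoly.mpoly n R * seq (mpoly.mpoly n R))) x :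
    (\big[setU/set0]_(b <- s) basic_semialgebraic b) x <->
    exists2 b, b \in s & basic_semialgebraic b x.
  rewrite -bigcup_seq; split; first by case=> b bs bx; exists b.
  by case=> b bs bx; exists b.
split=> -[s sA]; exists s.
  by move=> x; rewrite sA.
by apply/seteqP; split=> x; rewrite mem_bigU => /sA.
Qed.

Lemma eq_semialgebraic n (A B : set 'rV[R]_n) :
  (forall x, A x <-> B x) -> semialgebraic A -> semialgebraic B.
Proof. by move=> AB; rewrite (_ : A = B) //; apply/seteqP; split=> x /AB. Qed.

Lemma semialgebraic_set0 n : @semialgebraic R n set0.
Proof. by apply/semialgebraicP; exists [::] => x; split=> // -[]. Qed.

Lemma semialgebraicU n (A B : set 'rV[R]_n) :
  semialgebraic A -> semialgebraic B -> semialgebraic (A `|` B).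
Proof.
move=> /semialgebraicP[s sA] /semialgebraicP[t tB].
apply/semialgebraicP; exists (s ++ t) => x; split.
  by case=> [/sA|/tB] [b bs bx]; exists b => //; rewrite mem_cat bs ?orbT.
by case=> b; rewrite mem_cat => /orP[bs|bt] bx;
  [left; apply/sA|right; apply/tB]; exists b.
Qed.

(** Distributivity reduces to two basic sets, whose equations merge over an ordered field: [p = 0]
    and [q = 0] together amount to [p * p + q * q = 0]. *)
Lemma semialgebraicI n (A B : set 'rV[R]_n) :
  semialgebraic A -> semialgebraic B -> semialgebraic (A `&` B).
Proof.
move=> /semialgebraicP[s sA] /semialgebraicP[t tB].
pose cap (b c : mpoly.mpoly n R * seq (mpoly.mpoly n R)) :=
  (b.1 * b.1 + c.1 * c.1, b.2 ++ c.2).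
have capP b c x : basic_semialgebraic (cap b c) x <->
    basic_semialgebraic b x /\ basic_semialgebraic c x.
  rewrite /basic_semialgebraic /= pevalD !pevalM -!expr2; split.
    move=> [/eqP]; rewrite paddr_eq0 ?sqr_ge0// !sqrf_eq0 => /andP[/eqP-> /eqP->].
    by move=> bc; split; split=> // q qs; apply: bc; rewrite mem_cat qs ?orbT.
  move=> [[-> b2] [-> c2]]; rewrite expr0n addr0; split=> // q.
  by rewrite mem_cat => /orP[/b2|/c2].
apply/semialgebraicP; exists [seq cap b c | b <- s, c <- t] => x; split.
  move=> [/sA[b bs bx] /tB[c ct cx]]; exists (cap b c); last exact/capP.
  by apply/allpairsP; exists (b, c).
case=> _ /allpairsP[[b c] /= [bs ct ->]] /capP[bx cx].
by split; [apply/sA; exists b|apply/tB; exists c].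
Qed.

Lemma semialgebraic_eq0 n (f : 'rV[R]_n -> R) :
  polynomial_fun f -> semialgebraic [set x | f x = 0].
Proof.
move=> [p fp]; apply/semialgebraicP; exists [:: (p, [::])] => x; split.
  by rewrite /= fp => px; exists (p, [::]); rewrite ?mem_head.
by case=> b; rewrite inE => /eqP-> [/= px _]; rewrite fp.
Qed.

Lemma semialgebraic_gt0 n (f : 'rV[R]_n -> R) :
  polynomial_fun f -> semialgebraic [set x | 0 < f x].
Proof.
move=> [p fp]; apply/semialgebraicP; exists [:: (0, [:: p])] => x; split.
  rewrite /= fp => px; exists (0, [:: p]); rewrite ?mem_head//; split=> /=.
    by rewrite /peval mpoly.meval0.
  by move=> q; rewrite inE => /eqP->.
by case=> b; rewrite inE => /eqP-> [/= _ /(_ p (mem_head _ _))]; rewrite fp.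
Qed.

(** A basic set is a finite intersection of zero sets and positivity sets, so closure properties
    need checking only on these atoms. *)
Lemma semialgebraic_ind n (C : set (set 'rV[R]_n)) :
  C set0 ->
  (forall A B, C A -> C B -> C (A `|` B)) ->
  (forall A B, C A -> C B -> C (A `&` B)) ->
  (forall p, C [set x | peval p x = 0]) ->
  (forall p, C [set x | 0 < peval p x]) ->
  forall A, semialgebraic A -> C A.
Proof.
move=> C0 CU CI Ceq Cgt A [s ->].
elim: s => [|[p qs] s IHs]; first by rewrite big_nil.
rewrite big_cons; apply: (CU) => //.
rewrite (_ : basic_semialgebraic _ = [set x | peval p x = 0] `&`
  [set x | forall q, q \in qs -> 0 < peval q x])//; apply: (CI) => //.
elim: qs => [|q qs IHqs].
  rewrite (_ : mkset _ = [set x | peval (0 : mpoly.mpoly n R) x = 0])//.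
  by apply/seteqP; split=> x //= _; rewrite /peval mpoly.meval0.
rewrite (_ : mkset _ = [set x | 0 < peval q x] `&`
  [set x | forall q, q \in qs -> 0 < peval q x]); first exact: CI.
apply/seteqP; split=> x /= H.
  by split=> [|r rqs]; apply: H; rewrite inE ?eqxx// rqs orbT.
by move=> r; rewrite inE => /orP[/eqP->|]; [exact: H.1|exact: H.2].
Qed.

(** By De Morgan's laws only atoms matter, and trichotomy of the sign rewrites the negation of an
    atom as a union of two atoms. *)
Lemma semialgebraicC n (A : set 'rV[R]_n) :
  semialgebraic A -> semialgebraic (~` A).
Proof.
move: A; apply: (@semialgebraic_ind n (fun A => semialgebraic (~` A))).
- apply: (@eq_semialgebraic _ [set x | (fun=> 0) x = 0 :> R]).
    by move=> x; split=> // _ [].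
  exact/semialgebraic_eq0/polynomial_cst.
- by move=> A B sA sB; rewrite setCU; exact: semialgebraicI.
- by move=> A B sA sB; rewrite setCI; exact: semialgebraicU.
- move=> p; apply: (@eq_semialgebraic _
    ([set x | 0 < peval p x] `|` [set x | 0 < - peval p x])).
    move=> x; rewrite /= oppr_gt0; split=> [|/eqP].
      by case=> [p0 pE|p0 pE]; rewrite pE ltxx in p0.
    by rewrite neq_lt => /orP[]; [right|left].
  apply: semialgebraicU; apply: semialgebraic_gt0; first exact: polynomial_peval.
  exact/polynomialN/polynomial_peval.
- move=> p; apply: (@eq_semialgebraic _
    ([set x | peval p x = 0] `|` [set x | 0 < - peval p x])).
    move=> x; rewrite /= oppr_gt0; split=> [|/negP].
      by case=> [->|/lt_geF]; [rewrite ltxx|move=> + p0; rewrite ltW].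
    by rewrite -leNgt le_eqVlt => /orP[/eqP|]; [left|right].
  apply: semialgebraicU; first exact/semialgebraic_eq0/polynomial_peval.
  exact/semialgebraic_gt0/polynomialN/polynomial_peval.
Qed.

Lemma semialgebraic_preimage n k (u : 'rV[R]_n -> 'rV[R]_k) (A : set 'rV[R]_k) :
  polynomial_map u -> semialgebraic A -> semialgebraic [set v | A (u v)].
Proof.
move=> pu; move: A.
apply: (@semialgebraic_ind k (fun A => semialgebraic [set v | A (u v)])).
- exact: semialgebraic_set0.
- by move=> A B sA sB; exact: semialgebraicU sA sB.
- by move=> A B sA sB; exact: semialgebraicI sA sB.
- by move=> p; exact/semialgebraic_eq0/polynomial_comp.
- by move=> p; exact/semialgebraic_gt0/polynomial_comp.
Qed.

Lemma semialgebraic_eq n (f g : 'rV[R]_n -> R) :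
  polynomial_fun f -> polynomial_fun g -> semialgebraic [set x | f x = g x].
Proof.
move=> pf pg; apply: (@eq_semialgebraic _ [set x | f x - g x = 0]).
  by move=> x /=; split=> [/eqP|->]; rewrite ?subrr// subr_eq0 => /eqP.
exact/semialgebraic_eq0/polynomialD/polynomialN.
Qed.

Lemma semialgebraic_le n (f g : 'rV[R]_n -> R) :
  polynomial_fun f -> polynomial_fun g -> semialgebraic [set x | f x <= g x].
Proof.
move=> pf pg; apply: (@eq_semialgebraic _ (~` [set x | 0 < f x - g x])).
  by move=> x /=; rewrite subr_gt0 leNgt; split=> /negP.
exact/semialgebraicC/semialgebraic_gt0/polynomialD/polynomialN.
Qed.

Lemma semialgebraic_imply n (A B : set 'rV[R]_n) :
  semialgebraic A -> semialgebraic B -> semialgebraic [set x | A x -> B x].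
Proof.
move=> sA sB; apply: (@eq_semialgebraic _ (~` A `|` B)).
  move=> x; split=> /= [[nAx /nAx|Bx _]//|AB].
  by have [Ax|nAx] := pselect (A x); [right; exact: AB|left].
apply: semialgebraicU => //; exact: semialgebraicC.
Qed.

End Semialgebraic.

(** * Quantifier elimination and projections *)

Section QuantifierElimination.
Variable R : realType.

(** Valuation of first-order formulas: variable number [i] reads coordinate [i], and any variable
    from [n] on reads the default [0]. *)
Definition env n (v : 'rV[R]_n) : seq R := [seq v ord0 i | i <- enum 'I_n].

Lemma nth_env n (v : 'rV[R]_n) (i : 'I_n) : nth 0 (env v) i = v ord0 i.
Proof. by rewrite (nth_map i) ?size_enum_ord// nth_ord_enum. Qed.

Lemma size_env n (v : 'rV[R]_n) : size (env v) = n.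
Proof. by rewrite size_map size_enum_ord. Qed.

(** The semantics of [ord.Exists n] updates entry [n] of the valuation; hence it quantifies over an
    appended last coordinate. *)
Lemma env_row_mx n (v : 'rV[R]_n) (x : R) :
  env (row_mx v (x%:M : 'rV_1)) = set_nth 0 (env v) n x.
Proof.
have sz : size (set_nth 0 (env v) n x) = (n + 1)%N.
  by rewrite size_set_nth size_env addn1 (maxn_idPl _).
apply: (@eq_from_nth _ 0); rewrite size_env ?sz// => i lt_i.
rewrite (nth_env _ (Ordinal lt_i)) mxE nth_set_nth /=.
case: fintype.splitP => /= j ->.
  by rewrite ltn_eqF// nth_env.
by rewrite (ord1 j) addn0 eqxx mxE eqxx mulr1n.
Qed.

Lemma term_peval n (p : mpoly.mpoly n R) :
  exists t : GRing.term R, forall v, GRing.eval (env v) t = peval p v.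
Proof.
apply: (@peval_closed _ _ (fun g : 'rV[R]_n -> R =>
  exists t, forall v, GRing.eval (env v) t = g v)).
- by move=> c; exists (GRing.Const c).
- by move=> f g [t tf] [u ug]; exists (GRing.Add t u) => v; rewrite /= tf ug.
- by move=> f g [t tf] [u ug]; exists (GRing.Mul t u) => v; rewrite /= tf ug.
- by move=> i; exists (GRing.Var _ i) => v; rewrite /= nth_env.
Qed.

(** [GRing.rterm] excludes inverses, the only term constructor that is not polynomial. *)
Lemma polynomial_rterm n (t : GRing.term R) :
  GRing.rterm t -> @polynomial_fun R n (fun v => GRing.eval (env v) t).
Proof.
elim: t => //=.
- move=> i _; have [lt_in|le_ni] := ltnP i n.
    have [p pE] := @polynomial_map_id R n (Ordinal lt_in).
    by exists p => v; rewrite -pE -nth_env.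
  have [p pE] := @polynomial_cst R n 0.
  by exists p => v; rewrite -pE nth_default// size_env.
- by move=> c _; exact: polynomial_cst.
- by move=> k _; exact: polynomial_cst.
- by move=> t IHt u IHu /andP[/IHt pt /IHu pu]; exact: polynomialD.
- by move=> t IHt /IHt pt; exact: polynomialN.
- move=> t IHt k /IHt pt; under eq_fun do rewrite -mulr_natl.
  by apply: polynomialM => //; exact: polynomial_cst.
- by move=> t IHt u IHu /andP[/IHt pt /IHu pu]; exact: polynomialM.
- by move=> t IHt k /IHt pt; exact: polynomialX.
Qed.

Lemma formula_semialgebraic n (A : set 'rV[R]_n) : semialgebraic A ->
  exists f : ord.formula R, forall v, ord.holds (env v) f <-> A v.
Proof.
move: A; apply: (@semialgebraic_ind R n (fun A =>
  exists f : ord.formula R, forall v, ord.holds (env v) f <-> A v)).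
- by exists (@ord.Bool R false).
- move=> A B [f fA] [g gB]; exists (ord.Or f g) => v /=.
  by split=> -[/fA|/gB]; [left|right|left|right].
- move=> A B [f fA] [g gB]; exists (ord.And f g) => v /=.
  by split=> -[/fA ? /gB ?].
- move=> p; have [t tp] := term_peval p.
  by exists (ord.Equal t (GRing.Const 0)) => v; rewrite /= tp.
- move=> p; have [t tp] := term_peval p.
  by exists (ord.Lt (GRing.Const 0) t) => v; rewrite /= tp.
Qed.

Lemma semialgebraic_qf_eval n (f : ord.formula R) :
  ord.qf_form f -> ord.rformula f ->
  semialgebraic [set v : 'rV[R]_n | ord.qf_eval (env v) f].
Proof.
elim: f => //=.
- case=> _ _; last by apply: eq_semialgebraic (@semialgebraic_set0 R n) => v; split.
  apply: eq_semialgebraic (semialgebraicC (@semialgebraic_set0 R n)) => v.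
  by split=> // _ [].
- move=> t u _ /andP[rt ru].
  apply: eq_semialgebraic (semialgebraic_eq
    (polynomial_rterm n rt) (polynomial_rterm n ru)) => v.
  by split=> /eqP.
- move=> t u _ /andP[rt ru].
  apply: eq_semialgebraic (semialgebraicC (semialgebraic_le
    (polynomial_rterm n ru) (polynomial_rterm n rt))) => v.
  by rewrite /= ltNge; split=> /negP.
- move=> t u _ /andP[rt ru].
  exact: semialgebraic_le (polynomial_rterm n rt) (polynomial_rterm n ru).
- move=> f IHf g IHg /andP[qf qg] /andP[rf rg].
  apply: eq_semialgebraic (semialgebraicI (IHf qf rf) (IHg qg rg)) => v.
  by split=> /andP.
- move=> f IHf g IHg /andP[qf qg] /andP[rf rg].
  apply: eq_semialgebraic (semialgebraicU (IHf qf rf) (IHg qg rg)) => v.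
  by split=> /orP.
- move=> f IHf g IHg /andP[qf qg] /andP[rf rg].
  apply: eq_semialgebraic (semialgebraic_imply (IHf qf rf) (IHg qg rg)) => v.
  by split=> /implyP.
- move=> f IHf qf rf; apply: eq_semialgebraic (semialgebraicC (IHf qf rf)) => v.
  by split=> /negP.
Qed.

(** Tarski-Seidenberg for one coordinate: quantifier elimination over real closed fields gives a
    quantifier-free formula without inverses, whose solutions form a Boolean combination of
    atoms. *)
Lemma semialgebraic_exists_last n (A : set 'rV[R]_(n + 1)) : semialgebraic A ->
  semialgebraic [set v : 'rV[R]_n | exists x, A (row_mx v (x%:M : 'rV_1))].
Proof.
move=> /formula_semialgebraic[f fA].
have /andP[qg rg] := ord.quantifier_elim_wf (@qe_rcf.wf_QE_wproj R)
  (ord.to_rform_rformula (ord.Exists n f)).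
apply: eq_semialgebraic (semialgebraic_qf_eval n qg rg) => v /=.
have qeP := rwP (qe_rcf.rcf_satP (env v) (ord.Exists n f)).
split=> [/qeP /= [x]|[x Ax]]; first by rewrite -env_row_mx => /fA; exists x.
by apply/qeP; exists x; rewrite -env_row_mx; apply/fA.
Qed.

(** Induction on the number of quantified coordinates, eliminating the first coordinate of the block
    each time. *)
Lemma semialgebraic_exists n m (A : 'rV[R]_n -> 'rV[R]_m -> Prop) :
  semialgebraic [set z : 'rV[R]_(n + m) | A (lsubmx z) (rsubmx z)] ->
  semialgebraic [set v | exists w, A v w].
Proof.
elim: m A => [|m IHm] A sA.
  apply: eq_semialgebraic (semialgebraic_preimage
    (u := fun v => row_mx v (0 : 'rV_0)) _ sA) => [v|].
    rewrite /= row_mxKl row_mxKr; split=> [?|[w]]; first by exists 0.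
    by rewrite (thinmx0 w).
  exact/polynomial_map_row_mx/polynomial_map_cst/polynomial_map_id.
pose B (v : 'rV[R]_n) (w : 'rV[R]_m) :=
  exists x : R, A v (row_mx (x%:M : 'rV_1) w : 'rV_(1 + m)).
have sB : semialgebraic [set z : 'rV[R]_(n + m) | B (lsubmx z) (rsubmx z)].
  (* Elimination acts on the last coordinate; [u] moves it between [v] and the rest of the block. *)
  pose u (z : 'rV[R]_(n + m + 1)) : 'rV[R]_(n + (1 + m)) :=
    row_mx (lsubmx (lsubmx z)) (row_mx (rsubmx z) (rsubmx (lsubmx z))).
  have pu : polynomial_map u.
    apply: polynomial_map_row_mx.
      exact/polynomial_map_lsubmx/polynomial_map_lsubmx/polynomial_map_id.
    apply: polynomial_map_row_mx.
      exact/polynomial_map_rsubmx/polynomial_map_id.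
    exact/polynomial_map_rsubmx/polynomial_map_lsubmx/polynomial_map_id.
  have := semialgebraic_exists_last (semialgebraic_preimage pu sA).
  apply: eq_semialgebraic => v; rewrite /B /u /=.
  by split=> -[x Ax]; exists x; move: Ax; rewrite !row_mxKl !row_mxKr.
apply: eq_semialgebraic (IHm B sB) => v; split.
  by move=> [w [x]]; exists (row_mx x%:M w : 'rV_(1 + m)).
move=> [w Aw]; exists (rsubmx (w : 'rV_(1 + m))).
exists (lsubmx (w : 'rV_(1 + m)) ord0 ord0).
by rewrite -mx11_scalar hsubmxK.
Qed.

Lemma semialgebraic_forall n m (A : 'rV[R]_n -> 'rV[R]_m -> Prop) :
  semialgebraic [set z : 'rV[R]_(n + m) | A (lsubmx z) (rsubmx z)] ->
  semialgebraic [set v | forall w, A v w].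
Proof.
move=> sA; apply: eq_semialgebraic (semialgebraicC
  (@semialgebraic_exists n m (fun v w => ~ A v w) (semialgebraicC sA))) => v /=.
by split=> [/forallNP H w|Av [w]]; [exact: contrapT|exact].
Qed.

End QuantifierElimination.

(** * Value functions are semi-algebraic, semicontinuous and locally bounded *)

Section ValueFunctions.
Variable R : realType.

Lemma continuous_peval (T : topologicalType) n (u : T -> 'rV[R]_n) p :
  (forall i, continuous (fun t => u t ord0 i)) ->
  continuous (fun t => peval p (u t)).
Proof.
move=> cu; apply: (@peval_closed _ _ (fun g : T -> R => continuous g)) => //.
- by move=> c; exact: cst_continuous.
- by move=> f g cf cg t; exact: (@continuousD R R T f g t (cf t) (cg t)).
- by move=> f g cf cg t; exact: (@continuousM R T f g t (cf t) (cg t)).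
Qed.

Lemma closed_sublevel (T : topologicalType) (f : T -> R) c :
  continuous f -> closed [set x | f x <= c].
Proof.
by move=> cf; exact: (iffLR (continuous_closedP f) cf _ (@closed_le R c)).
Qed.

Lemma continuous_polynomial n (g : 'rV[R]_n -> R) :
  polynomial_fun g -> continuous g.
Proof.
move=> [p gE]; rewrite (_ : g = peval p); last exact/funext.
by apply: continuous_peval => i; exact: coord_continuous.
Qed.

Lemma continuous_peval2 (T : topologicalType) n m (p : mpoly.mpoly (n + m) R)
    (u : T -> 'rV[R]_n) (w : T -> 'rV[R]_m) :
  continuous u -> continuous w -> continuous (fun t => peval2 p (u t) (w t)).
Proof.
move=> cu cw; apply: continuous_peval => i.
under eq_fun do rewrite mxE.
by case: (fintype.split i) => j t;
  [apply: (cvg_comp u (fun x => x ord0 j)) (cu t) _|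
   apply: (cvg_comp w (fun x => x ord0 j)) (cw t) _]; exact: coord_continuous.
Qed.

Lemma peval_bounded n (p : mpoly.mpoly n R) (M : R) :
  exists B, forall x : 'rV[R]_n,
    (forall i, `|x ord0 i| <= M) -> `|peval p x| <= B.
Proof.
apply: (@peval_closed R _ (fun g : 'rV[R]_n -> R => exists B,
  forall x : 'rV[R]_n, (forall i, `|x ord0 i| <= M) -> `|g x| <= B) n id).
- by move=> c; exists `|c|.
- move=> f g [A fA] [B gB]; exists (A + B) => x xM.
  by rewrite (le_trans (ler_normD _ _))// lerD ?fA ?gB.
- move=> f g [A fA] [B gB]; exists (A * B) => x xM.
  by rewrite normrM ler_pM ?fA ?gB.
- by move=> i; exists M => x /(_ i).
Qed.

Lemma compact_box n (M : R) :
  compact [set x : 'rV[R]_n | forall i, `|x ord0 i| <= M].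
Proof.
rewrite [X in compact X](_ : _ =
  [set x : 'rV[R]_n | forall i, `[- M, M]%classic (x ord0 i)]).
  by apply: (@rV_compact _ _ (fun=> `[- M, M]%classic)) => _; exact: segment_compact.
by apply/seteqP; split=> x xM i; move: (xM i); rewrite /= in_itv /= ler_norml.
Qed.

Lemma closed_polynomial_le n (f g : 'rV[R]_n -> R) :
  polynomial_fun f -> polynomial_fun g -> closed [set x | f x <= g x].
Proof.
move=> pf pg; rewrite [X in closed X](_ : _ = [set x | f x - g x <= 0]).
  exact/closed_sublevel/continuous_polynomial/polynomialD/polynomialN.
by apply/seteqP; split=> x /=; rewrite subr_le0.
Qed.

Lemma compact_coord_bounded n (K : set 'rV[R]_n) : compact K ->
  exists M, forall x, K x -> forall i, `|x ord0 i| <= M.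
Proof.
move=> /compact_bounded[M [_ KM]]; exists (M + 1) => x Kx i.
have := KM (M + 1); rewrite ltrDl => /(_ ltr01 x Kx).
apply: le_trans; rewrite [leRHS]/Num.norm /= mx_normrE.
by apply/bigmax_geP; right; exists (ord0, i).
Qed.

Section Problem.
Variables (n m : nat) (P Q : mpoly.mpoly (n + m) R) (Y : set 'rV[R]_m).
Hypotheses (Y0 : Y !=set0) (cY : compact Y).

Lemma continuous_peval2r (p : mpoly.mpoly (n + m) R) x : continuous (peval2 p x).
Proof.
apply: continuous_polynomial; apply: polynomial_peval2.
  exact: polynomial_map_cst.
exact: polynomial_map_id.
Qed.

Lemma compact_exists_min (A : set 'rV[R]_m) (p : mpoly.mpoly (n + m) R) x :
  A !=set0 -> compact A ->
  exists2 y, A y & forall z, A z -> peval2 p x y <= peval2 p x z.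
Proof.
move=> A0 cA; have [y Ay ymin] := EVT_min_rV A0 cA
  (continuous_subspaceT (@continuous_peval2r p x)).
by exists y; [exact: set_mem|move=> z Az; exact/ymin/mem_set].
Qed.

Lemma Theta_nonempty x : Theta Q Y x !=set0.
Proof. by have [y Yy ymin] := compact_exists_min Q x Y0 cY; exists y. Qed.

Lemma compact_Theta x : compact (Theta Q Y x).
Proof.
have [y0 [Yy0 y0min]] := Theta_nonempty x.
rewrite (_ : Theta Q Y x = Y `&` [set y | peval2 Q x y <= peval2 Q x y0]).
  exact/(compact_closedI cY)/closed_sublevel/continuous_peval2r.
apply/seteqP; split=> y /= [Yy].
  by move=> ymin; split=> //; exact: ymin.
by move=> yy0; split=> // z Yz; exact/(le_trans yy0)/y0min.
Qed.

Lemma optimistic_valueE x y : Theta Q Y x y ->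
  (forall z, Theta Q Y x z -> peval2 P x y <= peval2 P x z) ->
  optimistic_value P Q Y x = (peval2 P x y)%:E.
Proof.
move=> Ty ymin; apply/eqP; rewrite eq_le; apply/andP; split.
  by apply: ereal_inf_lbound; exists y.
by apply/ereal_infP => _ [z Tz <-]; rewrite lee_fin; exact: ymin.
Qed.

Lemma optimistic_value_attained x : exists2 y, Theta Q Y x y &
  (forall z, Theta Q Y x z -> peval2 P x y <= peval2 P x z) /\
  optimistic_value P Q Y x = (peval2 P x y)%:E.
Proof.
have [y Ty ymin] := compact_exists_min P x (Theta_nonempty x) (@compact_Theta x).
by exists y => //; split=> //; exact: optimistic_valueE.
Qed.

(** Every [y] in [Y] either has [P] above [a] or is beaten by some [z] in [Y] for [Q]. Both
    alternatives are open in [(x, y)], so compactness of [Y] makes them hold for all [y] at once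
    when [x'] is near [x]; a minimizer at [x'] is never beaten. *)
Lemma optimistic_value_lsc : lower_semicontinuous (optimistic_value P Q Y).
Proof.
move=> x a ax; pose good x y := a < peval2 P x y \/
  exists2 z, Y z & peval2 Q x z < peval2 Q x y.
have goodx y : Y y -> good x y.
  move=> Yy; have [[z Yz zy]|ny] :=
    pselect (exists2 z, Y z & peval2 Q x z < peval2 Q x y).
    by right; exists z.
  left; rewrite -lte_fin; apply: (lt_le_trans ax); apply: ereal_inf_lbound.
  exists y => //; split=> // z Yz; rewrite leNgt; apply/negP => zy.
  by apply: ny; exists z.
have : \forall x' \near x, Y `<=` good x'.
  apply: (iffLR (compact_near_coveringP Y) cY _ (nbhs x) good _) => y Yy.
  have c1 : continuous (@fst 'rV[R]_m 'rV[R]_n) by move=> z; exact: cvg_fst.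
  have c2 : continuous (@snd 'rV[R]_m 'rV[R]_n) by move=> z; exact: cvg_snd.
  case: (goodx y Yy) => [aP|[z Yz zy]].
    have /(_ (nbhs_filter (y, x))) := @cvgr_gt _ _ _ _ _ _
      (@continuous_peval2 _ _ _ P _ _ c2 c1 (y, x)) a aP.
    by apply: filterS => -[y' x'] /= ?; left.
  have cz : continuous (fun=> z : 'rV[R]_m) :=
    @cst_continuous ('rV[R]_m * 'rV[R]_n)%type _ z.
  have /(_ (nbhs_filter (y, x))) := @cvgr_gt _ _ _ _ _ _ (cvgB
    (@continuous_peval2 _ _ _ Q _ _ c2 c1 (y, x))
    (@continuous_peval2 _ _ _ Q _ _ c2 cz (y, x))) 0.
  rewrite subr_gt0 => /(_ (nbhs_filter (y, x)) zy); apply: filterS => -[y' x'] /=.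
  by rewrite subr_gt0; right; exists z.
exists [set x' | Y `<=` good x'] => // x' Yx'.
have [y [Yy ymin] [_ ->]] := optimistic_value_attained x'.
rewrite lte_fin; case: (Yx' y Yy) => // -[z Yz].
by rewrite ltNge ymin.
Qed.

(** The value is attained at a point of [Y], and a polynomial is bounded on a box containing the
    compact set times [Y]. *)
Lemma optimistic_value_CB : CB R n (optimistic_value P Q Y).
Proof.
exists (fun x => fine (optimistic_value P Q Y x)).
  apply/funext => x /=; have [y _ [_ ->]] := optimistic_value_attained x.
  by [].
move=> K /compact_coord_bounded[M KM].
have [M' YM'] := compact_coord_bounded cY.
have [B PB] := peval_bounded P (Num.max M M').
exists B; split; first exact: num_real.
move=> B' ltBB' x Kx; have [y [Yy _] [_ Py]] := optimistic_value_attained x.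
rewrite /= Py /=.
apply: le_trans (ltW ltBB'); apply: PB => i.
rewrite mxE le_max; case: (fintype.split i) => j.
  by rewrite KM.
by rewrite YM' ?orbT.
Qed.

(** Minimality costs one universal quantifier. The maps [u] and [w] allow use inside formulas with
    further variables. *)
Lemma semialgebraic_Theta k (u : 'rV[R]_k -> 'rV[R]_n) (w : 'rV[R]_k -> 'rV[R]_m) :
  semialgebraic Y -> polynomial_map u -> polynomial_map w ->
  semialgebraic [set v | Theta Q Y (u v) (w v)].
Proof.
move=> sY pu pw; apply: semialgebraicI; first exact: semialgebraic_preimage.
apply: (@semialgebraic_forall _ _ _ (fun v y' => Y y' -> _ <= peval2 Q (u v) y')).
have pl := @polynomial_map_lsubmx R _ k m _ (@polynomial_map_id R (k + m)).
have pr := @polynomial_map_rsubmx R _ k m _ (@polynomial_map_id R (k + m)).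
apply: semialgebraic_imply; first exact: semialgebraic_preimage.
have comp j (f : 'rV[R]_k -> 'rV[R]_j) : polynomial_map f ->
    polynomial_map (fun z : 'rV[R]_(k + m) => f (lsubmx z)).
  move=> pf i; have [p pE] := pf i.
  by under eq_fun do rewrite pE; exact: polynomial_comp.
by apply: semialgebraic_le; apply: polynomial_peval2 => //; exact: comp.
Qed.

Lemma optimistic_value_SA : semialgebraic Y -> SA R n (optimistic_value P Q Y).
Proof.
move=> sY; have fin x : optimistic_value P Q Y x \is a fin_num.
  by have [y _ [_ ->]] := optimistic_value_attained x.
split.
- apply: eq_semialgebraic (semialgebraicC (@semialgebraic_set0 R n)) => x /=.
  by split=> // _ [].
- apply: eq_semialgebraic (@semialgebraic_set0 R n) => x /=; split=> // xE.
  by have := fin x; rewrite xE.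
- apply: eq_semialgebraic (@semialgebraic_set0 R n) => x /=; split=> // xE.
  by have := fin x; rewrite xE.
(* Attainment lets the graph be described by the existence of a minimizer, with no infimum. *)
pose A (z : 'rV[R]_(n + 1)) (y : 'rV[R]_m) := [/\ Theta Q Y (lsubmx z) y,
  peval2 P (lsubmx z) y = rsubmx z ord0 ord0 &
  forall y', Theta Q Y (lsubmx z) y' ->
    peval2 P (lsubmx z) y <= peval2 P (lsubmx z) y'].
apply: (@eq_semialgebraic _ _ [set z | exists y, A z y]).
  move=> z; rewrite /finite_graph /=; split.
    by move=> [y [Ty <- ymin]]; exact: optimistic_valueE.
  have [y Ty [ymin ->]] := optimistic_value_attained (lsubmx z).
  by move=> [Pyz]; exists y.
apply: semialgebraic_exists; apply: (@eq_semialgebraic _ _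
  ([set w : 'rV[R]_(n + 1 + m) | Theta Q Y (lsubmx (lsubmx w)) (rsubmx w)] `&`
   [set w | peval2 P (lsubmx (lsubmx w)) (rsubmx w) =
     rsubmx (lsubmx w) ord0 ord0] `&`
   [set w | forall y', Theta Q Y (lsubmx (lsubmx w)) y' ->
     peval2 P (lsubmx (lsubmx w)) (rsubmx w) <= peval2 P (lsubmx (lsubmx w)) y'])).
  by move=> w; split=> [[[]]|[]].
have pl a b := @polynomial_map_lsubmx R _ a b _ (@polynomial_map_id R (a + b)).
have pr a b := @polynomial_map_rsubmx R _ a b _ (@polynomial_map_id R (a + b)).
apply: semialgebraicI; first apply: semialgebraicI.
- apply: semialgebraic_Theta => //; exact: polynomial_map_lsubmx.
- apply: semialgebraic_eq; last exact: polynomial_map_rsubmx.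
  by apply: polynomial_peval2 => //; exact: polynomial_map_lsubmx.
apply: (@semialgebraic_forall _ _ _ (fun w y' => Theta Q Y (lsubmx (lsubmx w)) y' ->
  peval2 P (lsubmx (lsubmx w)) (rsubmx w) <= peval2 P (lsubmx (lsubmx w)) y')).
apply: semialgebraic_imply.
  by apply: semialgebraic_Theta => //; do 2!apply: polynomial_map_lsubmx.
by apply: semialgebraic_le; apply: polynomial_peval2 => //;
  [do 2!apply: polynomial_map_lsubmx|apply: polynomial_map_rsubmx|
   do 2!apply: polynomial_map_lsubmx].
Qed.

End Problem.
End ValueFunctions.

(** * The Euclidean inner product *)

Section Dot.
Variable R : realType.

Definition dot n (a b : 'rV[R]_n) : R := (a *m b^T) ord0 ord0.

Lemma dotE n (a b : 'rV[R]_n) : dot a b = \sum_i a ord0 i * b ord0 i.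
Proof. by rewrite /dot mxE; apply: eq_bigr => i _; rewrite mxE. Qed.

Lemma dotC n (a b : 'rV[R]_n) : dot a b = dot b a.
Proof. by rewrite !dotE; apply: eq_bigr => i _; rewrite mulrC. Qed.

Lemma dotDl n (a b c : 'rV[R]_n) : dot (a + b) c = dot a c + dot b c.
Proof. by rewrite /dot mulmxDl mxE. Qed.

Lemma dotDr n (a b c : 'rV[R]_n) : dot c (a + b) = dot c a + dot c b.
Proof. by rewrite !(dotC c) dotDl. Qed.

Lemma dotZl n k (a b : 'rV[R]_n) : dot (k *: a) b = k * dot a b.
Proof. by rewrite /dot -scalemxAl mxE. Qed.

Lemma dotZr n k (a b : 'rV[R]_n) : dot a (k *: b) = k * dot a b.
Proof. by rewrite dotC dotZl dotC. Qed.

Lemma dotNl n (a b : 'rV[R]_n) : dot (- a) b = - dot a b.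
Proof. by rewrite -scaleN1r dotZl mulN1r. Qed.

Lemma dotNr n (a b : 'rV[R]_n) : dot a (- b) = - dot a b.
Proof. by rewrite dotC dotNl dotC. Qed.

Lemma dot0l n (a : 'rV[R]_n) : dot 0 a = 0.
Proof. by rewrite -(scale0r 0) dotZl mul0r. Qed.

Lemma dot_row_mx n m (a b : 'rV[R]_n) (c d : 'rV[R]_m) :
  dot (row_mx a c) (row_mx b d) = dot a b + dot c d.
Proof. by rewrite /dot tr_row_mx mul_row_col mxE. Qed.

Lemma dot_scalar (x y : R) : dot (x%:M : 'rV_1) y%:M = x * y.
Proof. by rewrite /dot tr_scalar_mx -scalar_mxM mxE eqxx mulr1n. Qed.

Lemma sqr_coord_le_dot n (a : 'rV[R]_n) i : a ord0 i ^+ 2 <= dot a a.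
Proof.
by rewrite dotE (bigD1 i)//= -expr2 lerDl sumr_ge0// => j _; rewrite -expr2 sqr_ge0.
Qed.

Lemma dot_ge0 n (a : 'rV[R]_n) : 0 <= dot a a.
Proof. by rewrite dotE sumr_ge0// => j _; rewrite -expr2 sqr_ge0. Qed.

Lemma dot_le0 n (a : 'rV[R]_n) : dot a a <= 0 -> a = 0.
Proof.
move=> a0; apply/rowP => i; rewrite mxE; apply/eqP; rewrite -sqrf_eq0.
by rewrite eq_le sqr_ge0 (le_trans (sqr_coord_le_dot a i)).
Qed.

Lemma polynomial_dot k n (u w : 'rV[R]_k -> 'rV[R]_n) :
  polynomial_map u -> polynomial_map w -> polynomial_fun (fun v => dot (u v) (w v)).
Proof.
move=> pu pw; under eq_fun do rewrite dotE.
by apply: polynomial_sum => i; exact: polynomialM.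
Qed.

End Dot.

(** * Polynomial growth of semi-algebraic functions *)

Section Growth.
Variable R : realType.

(* The regions [r >= N + 1, t >= r ^ N] form a filter basis; on such regions
   every polynomial in (r, t) has constant sign. *)
Definition germ (S : R -> R -> Prop) := exists N : nat, forall r t,
  N.+1%:R <= r -> r ^+ N <= t -> S r t.

Lemma germS (S T : R -> R -> Prop) :
  (forall r t, S r t -> T r t) -> germ S -> germ T.
Proof. by move=> ST [N SN]; exists N => r t rN tN; exact/ST/SN. Qed.

Lemma germI (S T : R -> R -> Prop) :
  germ S -> germ T -> germ (fun r t => S r t /\ T r t).
Proof.
move=> [N SN] [M TM]; exists (N + M)%N => r t rNM tNM.
have leN : (N.+1%:R <= r :> R) by rewrite (le_trans _ rNM)// ler_nat ltnS leq_addr.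
have leM : (M.+1%:R <= r :> R) by rewrite (le_trans _ rNM)// ler_nat ltnS leq_addl.
have r1 : 1 <= r by rewrite (le_trans _ rNM)// ler1n.
split; [apply: SN => //|apply: TM => //]; apply: le_trans tNM.
  by rewrite ler_weXn2l ?leq_addr.
by rewrite ler_weXn2l ?leq_addl.
Qed.

Lemma horner_bound (c : {poly R}) :
  exists2 B, 0 <= B & exists M, forall r, 1 <= r -> `|c.[r]| <= B * r ^+ M.
Proof.
elim/poly_ind: c => [|c a [B B0 [M cM]]].
  by exists 0 => //; exists 0%N => r _; rewrite horner0 normr0 mul0r.
exists (B + `|a|); first by rewrite addr_ge0.
exists M.+1 => r r1; rewrite hornerMXaddC (le_trans (ler_normD _ _))//.
have r0 : 0 <= r by rewrite (le_trans ler01).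
rewrite mulrDl lerD//; last by rewrite ler_peMr// exprn_ege1.
by rewrite normrM (ger0_norm r0) exprSr mulrA ler_wpM2r ?cM.
Qed.

(** One factor [r] absorbs the constant [K * (B + 1)], the others absorb the degree. The shape
    [K * |c| + K] is made to dominate [1 + |c| / e] when [K = 1 + 1 / e]. *)
Lemma germ_horner_le (c : {poly R}) K :
  0 <= K -> germ (fun r t => K * `|c.[r]| + K <= t).
Proof.
move=> K0; have [B B0 [M cM]] := horner_bound c.
pose N := (M + Num.bound (K * (B + 1)))%N.
exists N.+1 => r t rN; apply: le_trans.
have r1 : 1 <= r by rewrite (le_trans _ rN)// ler1n.
have leK : K * (B + 1) <= r.
  apply: le_trans (ltW (archi_boundP _)) _; first by rewrite mulr_ge0// addr_ge0.
  by apply: le_trans rN; rewrite ler_nat /N (leq_trans (leq_addl M _))// leqW.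
apply: (@le_trans _ _ (r * r ^+ M)); last first.
  by rewrite -exprS ler_weXn2l// ltnS leq_addr.
apply: (@le_trans _ _ (K * (B + 1) * r ^+ M)); last first.
  by rewrite ler_wpM2r// exprn_ge0// (le_trans ler01).
rewrite -mulrA -[X in _ + X]mulr1 -mulrDr ler_wpM2l// mulrDl mul1r lerD ?cM//.
exact: exprn_ege1.
Qed.

(** A positive lower bound on [s * g], rather than the bare sign of [g], carries an induction along
    Horner's scheme: the leading part must outweigh the next coefficient. *)
Definition away_from0 (g : R -> R -> R) :=
  exists e s, [/\ 0 < e, `|s| = 1 & germ (fun r t => e <= s * g r t)].

Lemma away_from0_horner (c : {poly R}) : c != 0 -> away_from0 (fun r _ => c.[r]).
Proof.
elim/poly_ind: c => [|q a IHq]; first by rewrite eqxx.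
have [->|q0 _] := eqVneq q 0.
  rewrite mul0r add0r polyC_eq0 => a0; exists `|a|, (Num.sg a).
  rewrite normr_gt0 normr_sg a0; split=> //; exists 0%N => r t _ _.
  by rewrite hornerC -normrEsg.
have [e [s [e0 s1 sq]]] := IHq q0; exists e, s; split=> //.
(* The threshold makes [e * b - |a| = e], so the same [e] and [s] still serve after adding the
   coefficient [a]. *)
pose b := 1 + `|a| / e.
have gb : germ (fun r _ => b <= r).
  exists (Num.bound b) => r t rN _; apply: le_trans rN.
  have b0 : 0 <= b by rewrite addr_ge0// divr_ge0// ltW.
  by rewrite (le_trans (ltW (archi_boundP b0)))// ler_nat.
apply: germS (germI sq gb) => r t [se br]; rewrite hornerMXaddC mulrDr mulrA.
have -> : e = e * b - `|a|.
  by rewrite mulrDr mulr1 mulrCA divff ?gt_eqF// mulr1 addrK.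
apply: lerD.
  by rewrite ler_pM ?(ltW e0)// addr_ge0// divr_ge0// ltW.
by rewrite -[`|a|]mul1r -s1 -normrM lerNl -normrN ler_norm.
Qed.

(** Horner's scheme in [t] with coefficients polynomial in [r]: the threshold [1 + |c(r)| / e]
    depends on [r], and [t >= r ^ N] exceeds it for a suitable [N]. *)
Lemma away_from0_horner2 (p : {poly {poly R}}) :
  p != 0 -> away_from0 (fun r t => p.[t%:P].[r]).
Proof.
elim/poly_ind: p => [|q c IHq]; first by rewrite eqxx.
have [->|q0 _] := eqVneq q 0.
  rewrite mul0r add0r polyC_eq0 => /away_from0_horner[e [s [e0 s1 sc]]].
  by exists e, s; split=> //; apply: germS sc => r t; rewrite hornerC.
have [e [s [e0 s1 sq]]] := IHq q0; exists e, s; split=> //.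
have K0 : 0 <= 1 + e^-1 by rewrite addr_ge0// invr_ge0 ltW.
apply: germS (germI sq (germ_horner_le c K0)) => r t [se ct].
rewrite hornerMXaddC hornerD hornerM hornerC mulrDr mulrA.
have bt : 1 + `|c.[r]| / e <= t.
  apply: le_trans ct; rewrite addrC lerD//.
    by rewrite mulrDl mul1r [X in _ + X]mulrC lerDr.
  by rewrite lerDl invr_ge0 ltW.
have -> : e = e * (1 + `|c.[r]| / e) - `|c.[r]|.
  by rewrite mulrDr mulr1 mulrCA divff ?gt_eqF// mulr1 addrK.
apply: lerD.
  by rewrite ler_pM ?(ltW e0)// addr_ge0// divr_ge0// ltW.
by rewrite -[`|c.[r]|]mul1r -s1 -normrM lerNl -normrN ler_norm.
Qed.

Definition pair_rV (r t : R) : 'rV[R]_(1 + 1) := row_mx r%:M t%:M.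

Lemma peval_pair (p : mpoly.mpoly (1 + 1) R) :
  exists q : {poly {poly R}}, forall r t, peval p (pair_rV r t) = q.[t%:P].[r].
Proof.
(* The outer variable of [q] is [t], the inner one [r]; the arguments are paired to fit
   [peval_closed]. *)
suff [q qE] : exists q : {poly {poly R}},
    forall z : R * R, peval p (pair_rV z.1 z.2) = q.[z.2%:P].[z.1].
  by exists q => r t; rewrite (qE (r, t)).
apply: (@peval_closed R (R * R) (fun g => exists q : {poly {poly R}},
  forall z : R * R, g z = q.[z.2%:P].[z.1]) (1 + 1) (fun z => pair_rV z.1 z.2)).
- by move=> c; exists c%:P%:P => z; rewrite !hornerC.
- by move=> f g [a fa] [b gb]; exists (a + b) => z; rewrite !hornerD fa gb.
- by move=> f g [a fa] [b gb]; exists (a * b) => z; rewrite !hornerM fa gb.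
- move=> i; rewrite -(splitK i); case: (fintype.split i) => j; rewrite (ord1 j) /=.
    by exists ('X%:P) => z; rewrite row_mxEl mxE eqxx mulr1n hornerC hornerX.
  by exists 'X => z; rewrite row_mxEr mxE eqxx mulr1n hornerX hornerC.
Qed.

(** Each polynomial has an eventually constant sign along the basis, and the dichotomy survives
    unions and intersections. *)
Lemma germ_semialgebraic (A : set 'rV[R]_(1 + 1)) : semialgebraic A ->
  germ (fun r t => A (pair_rV r t)) \/ germ (fun r t => ~ A (pair_rV r t)).
Proof.
have sign p : exists s, germ (fun r t => Num.sg (peval p (pair_rV r t)) = s).
  have [q qE] := peval_pair p.
  have [q0|/away_from0_horner2[e [s [e0 s1 sq]]]] := eqVneq q 0.
    by exists 0; exists 0%N => r t _ _; rewrite qE q0 !horner0 sgr0.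
  exists s; apply: germS sq => r t; rewrite -qE => /(lt_le_trans e0) s0.
  have : Num.sg (s * peval p (pair_rV r t)) = 1 by rewrite gtr0_sg.
  have ss : Num.sg s = s by rewrite [RHS]numEsg s1 mulr1.
  rewrite sgrM ss => sp; have s2 : s * s = 1.
    by rewrite -expr2 -real_normK ?num_real// s1 expr1n.
  by rewrite -[LHS]mul1r -s2 -mulrA sp mulr1.
move: A; apply: (@semialgebraic_ind R (1 + 1) (fun A =>
  germ (fun r t => A (pair_rV r t)) \/ germ (fun r t => ~ A (pair_rV r t)))).
- by right; exists 0%N => r t _ _ [].
- move=> A B [gA _|gA [gB|gB]]; first by left; apply: germS gA => r t; left.
    by left; apply: germS gB => r t; right.
  by right; apply: germS (germI gA gB) => r t [nA nB] [].
- move=> A B [gA [gB|gB]|gA _]; first by left; apply: germS (germI gA gB) => r t [].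
    by right; apply: germS gB => r t nB [].
  by right; apply: germS gA => r t nA [].
- move=> p; have [s sp] := sign p; have [s0|s0] := eqVneq s 0.
    by left; apply: germS sp => r t; rewrite s0 => /eqP; rewrite sgr_eq0 => /eqP.
  by right; apply: germS sp => r t sE /= p0; rewrite -sE p0 sgr0 eqxx in s0.
- move=> p; have [s sp] := sign p; have [s0|s0] := ltP 0 s.
    by left; apply: germS sp => r t sE /=; rewrite -sgr_gt0 sE.
  by right; apply: germS sp => r t sE /=; rewrite -sgr_gt0 sE ltNge s0.
Qed.

Lemma semialgebraic_growth n (f : 'rV[R]_n -> R) :
  semialgebraic_fun f -> bounded_on_compacts f ->
  exists N : nat, forall x, `|f x| <= (N.+1%:R + dot x x) ^+ N.
Proof.
move=> sf bf.
(* [G] collects the pairs [(r, t)] such that [|f| <= t] on the ball of squared radius [r]; ranging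
   over graph points keeps the formula polynomial. *)
pose G := [set v : 'rV[R]_(1 + 1) | forall z : 'rV[R]_(n + 1), graph f z ->
  dot (lsubmx z) (lsubmx z) <= lsubmx v ord0 ord0 ->
  rsubmx z ord0 ord0 <= rsubmx v ord0 ord0 /\
  - rsubmx z ord0 ord0 <= rsubmx v ord0 ord0].
have GP r t : G (pair_rV r t) <-> forall x, dot x x <= r -> `|f x| <= t.
  rewrite /G /pair_rV /= row_mxKl row_mxKr !mxE eqxx !mulr1n; split=> H.
    move=> x xr; have := H (row_mx x (f x)%:M).
    rewrite /graph /= row_mxKl row_mxKr mxE eqxx mulr1n => /(_ erefl xr)[ft ft'].
    by rewrite ler_norml lerNl ft ft'.
  move=> z <- zr; have := H _ zr; rewrite ler_norml lerNl => /andP[].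
  by [].
have sG : semialgebraic G.
  apply: semialgebraic_forall.
  have pl a b := @polynomial_map_lsubmx R _ a b _ (@polynomial_map_id R (a + b)).
  have pr a b := @polynomial_map_rsubmx R _ a b _ (@polynomial_map_id R (a + b)).
  apply: semialgebraic_imply; first exact: semialgebraic_preimage.
  apply: semialgebraic_imply.
    apply: semialgebraic_le; last exact: polynomial_map_lsubmx.
    by apply: polynomial_dot; exact: polynomial_map_lsubmx.
  apply: semialgebraicI; apply: semialgebraic_le;
    try apply: polynomialN; exact: polynomial_map_rsubmx.
have [|] := germ_semialgebraic sG.
  (* Evaluate at [r = N + 1 + |x|^2] and [t = r ^ N]: this [r] is admissible and its ball contains
     [x]. *)
  move=> [N GN]; exists N => x.
  by apply: (iffLR (GP _ _) (GN (N.+1%:R + dot x x) _ _ _)) => //;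
    rewrite ?lerDl ?lerDr ?dot_ge0.
move=> [N GN]; exfalso.
(* Otherwise, at [r = N + 1], membership in [G] fails for every [t >= r ^ N], against the
   boundedness of [f] on that ball. *)
pose r : R := N.+1%:R.
have : exists M, forall x, dot x x <= r -> `|f x| <= M.
  (* The ball of squared radius [r] lies in the box of half-width [1 + r], as [(1 + r) ^ 2 > r]. *)
  have [M [_ fM]] := bf _ (@compact_box R n (1 + r)).
  exists (M + 1) => x xr; apply: fM; rewrite ?ltrDl//= => i.
  have := le_trans (sqr_coord_le_dot x i) xr.
  rewrite -real_normK ?num_real// => xir.
  rewrite leNgt; apply/negP => rx.
  have r0 : 0 <= r by [].
  have : (1 + r) * (1 + r) <= r.
    apply: le_trans xir; rewrite expr2; apply: ler_pM; rewrite ?(ltW rx)// addr_ge0//.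
  nra.
move=> [M fM]; apply: (GN r (Num.max M (r ^+ N))) => //.
  by rewrite le_max lexx orbT.
by apply/GP => x /fM; rewrite le_max => ->.
Qed.

End Growth.

(** * Inverse stereographic projection *)

Section Stereographic.
Variables (R : realType) (n : nat).
Implicit Types x : 'rV[R]_n.

Definition sqnorm1 x : R := 1 + dot x x.

(* [stereo x] is the inverse stereographic projection of [x] multiplied by
   [sqnorm1 x], so that its coordinates are polynomials in [x]. *)
Definition stereo x : 'rV[R]_(n + 1) := row_mx (2 *: x) (dot x x - 1)%:M.

Lemma sqnorm1_ge1 x : 1 <= sqnorm1 x.
Proof. by rewrite lerDl dot_ge0. Qed.

Lemma sqnorm1_gt0 x : 0 < sqnorm1 x.
Proof. by rewrite (lt_le_trans ltr01)// sqnorm1_ge1. Qed.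

(** Chordal distance formula, with denominators cleared. It lets an affine function on the sphere
    penalize the distance to a given point. *)
Lemma dot_stereo x y : dot (stereo x) (stereo y) =
  sqnorm1 x * sqnorm1 y - 2 * dot (x - y) (x - y).
Proof.
rewrite dot_row_mx dot_scalar dotZl dotZr dotDl !dotDr !dotNl !dotNr (dotC y x).
rewrite /sqnorm1; ring.
Qed.

Lemma dot_stereo_sqr x : dot (stereo x) (stereo x) = sqnorm1 x ^+ 2.
Proof. by rewrite dot_stereo subrr dot0l mulr0 subr0. Qed.

(** Expanding this square yields the Cauchy-Schwarz bound on the unit ball in [dot_stereo_le] and
    its equality case in [stereo_maximal]. *)
Lemma stereo_dist_sqr x (s : 'rV[R]_(n + 1)) :
  dot (sqnorm1 x *: s - stereo x) (sqnorm1 x *: s - stereo x) =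
  sqnorm1 x ^+ 2 * (dot s s + 1) - 2 * sqnorm1 x * dot (stereo x) s.
Proof.
rewrite dotDl !dotDr !dotNl !dotNr !dotZl !dotZr dot_stereo_sqr (dotC s); ring.
Qed.

Lemma dot_stereo_le x s : dot s s <= 1 -> dot (stereo x) s <= sqnorm1 x.
Proof.
move=> s1; have q0 := sqnorm1_gt0 x.
rewrite -(ler_pM2l q0); have := dot_ge0 (sqnorm1 x *: s - stereo x).
rewrite stereo_dist_sqr; have := ler_wpM2l (sqr_ge0 (sqnorm1 x)) s1; lra.
Qed.

Lemma stereo_maximal x s : dot s s <= 1 -> sqnorm1 x <= dot (stereo x) s ->
  sqnorm1 x *: s = stereo x.
Proof.
move=> s1 sx; apply/eqP; rewrite -subr_eq0; apply/eqP/dot_le0.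
rewrite stereo_dist_sqr; have := ler_wpM2l (sqr_ge0 (sqnorm1 x)) s1.
have := ler_wpM2l (ltW (sqnorm1_gt0 x)) sx; lra.
Qed.

(** The right side minus the left is [1 + |x - 2 y|^2]. *)
Lemma sqnorm1_le x y : sqnorm1 x <= 2 * sqnorm1 y + 2 * dot (x - y) (x - y).
Proof.
have := dot_ge0 (x - 2 *: y).
rewrite !dotDl !dotDr !dotNl !dotNr !dotZl !dotZr (dotC y x) /sqnorm1; lra.
Qed.

Lemma polynomial_sqnorm1 k (u : 'rV[R]_k -> 'rV[R]_n) :
  polynomial_map u -> polynomial_fun (fun v => sqnorm1 (u v)).
Proof.
by move=> pu; apply: polynomialD; [exact: polynomial_cst|exact: polynomial_dot].
Qed.

Lemma polynomial_map_stereo k (u : 'rV[R]_k -> 'rV[R]_n) :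
  polynomial_map u -> polynomial_map (fun v => stereo (u v)).
Proof.
move=> pu; apply: polynomial_map_row_mx.
  by apply: polynomial_mapZ => //; exact: polynomial_cst.
apply: polynomial_map_scalar; apply: polynomialD; first exact: polynomial_dot.
exact: polynomial_cst.
Qed.

End Stereographic.

(** * The envelope as lower-level feasible set *)

Section Construction.
Variables (R : realType) (n : nat) (f : 'rV[R]_n -> R) (C : R) (K : nat).
Hypothesis sf : semialgebraic_fun f.
Hypothesis lf : lower_semicontinuous (EFin \o f).
Hypothesis fC : forall x, `|f x| <= C * sqnorm1 x ^+ K.+1.

Let height (y : 'rV[R]_(n + 1 + 1)) := rsubmx y ord0 ord0.

(** The row [l] encodes the affine function [s |-> <lsubmx l, s> + height l], compared with
    [f x / sqnorm1 x ^ (K + 1)] at the sphere point [stereo x / sqnorm1 x]. Clearing denominators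
    leaves a polynomial inequality. *)
Definition minorant (l : 'rV[R]_(n + 1 + 1)) := forall x,
  (dot (lsubmx l) (stereo x) + height l * sqnorm1 x) * sqnorm1 x ^+ K <= f x.

(* The lower convex envelope of [f / sqnorm1 ^ (K + 1)], a bounded function on
   the punctured unit sphere, truncated at height [C]. *)
Definition envelope : set 'rV[R]_(n + 1 + 1) := [set y |
  [/\ dot (lsubmx y) (lsubmx y) <= 1, height y <= C &
      forall l, minorant l -> dot (lsubmx l) (lsubmx y) + height l <= height y]].

Lemma C_ge0 : 0 <= C.
Proof.
have := le_trans (normr_ge0 _) (fC 0).
by rewrite pmulr_lge0// exprn_gt0// sqnorm1_gt0.
Qed.

Lemma polynomial_height k (u : 'rV[R]_k -> 'rV[R]_(n + 1 + 1)) :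
  polynomial_map u -> polynomial_fun (fun v => height (u v)).
Proof. by move=> pu; exact: polynomial_map_rsubmx. Qed.

Lemma semialgebraic_minorant : semialgebraic minorant.
Proof.
have pl a b := @polynomial_map_lsubmx R _ a b _ (@polynomial_map_id R (a + b)).
have pr a b := @polynomial_map_rsubmx R _ a b _ (@polynomial_map_id R (a + b)).
(* Ranging over points of the graph turns [f x] into a variable. *)
apply: (@eq_semialgebraic _ _ [set l | forall z : 'rV[R]_(n + 1), graph f z ->
  (dot (lsubmx l) (stereo (lsubmx z)) + height l * sqnorm1 (lsubmx z)) *
  sqnorm1 (lsubmx z) ^+ K <= rsubmx z ord0 ord0]).
  move=> l; split=> /= [H x|H z <-]; last exact: H.
  have := H (row_mx x (f x)%:M).
  by rewrite /graph /= row_mxKl row_mxKr mxE eqxx mulr1n; exact.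
apply: semialgebraic_forall; apply: semialgebraic_imply.
  exact: semialgebraic_preimage.
have pz := polynomial_map_lsubmx (pr (n + 1 + 1)%N (n + 1)%N).
apply: semialgebraic_le; last exact: polynomial_map_rsubmx.
apply: polynomialM; last by apply: polynomialX; exact: polynomial_sqnorm1.
apply: polynomialD.
  apply: polynomial_dot; first exact: polynomial_map_lsubmx.
  exact: polynomial_map_stereo.
by apply: polynomialM; [exact: polynomial_height|exact: polynomial_sqnorm1].
Qed.

Lemma semialgebraic_envelope : semialgebraic envelope.
Proof.
have pl a b := @polynomial_map_lsubmx R _ a b _ (@polynomial_map_id R (a + b)).
have pr a b := @polynomial_map_rsubmx R _ a b _ (@polynomial_map_id R (a + b)).
apply: (@eq_semialgebraic _ _
  ([set y | dot (lsubmx y) (lsubmx y) <= 1] `&` [set y | height y <= C] `&`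
   [set y | forall l, minorant l ->
      dot (lsubmx l) (lsubmx y) + height l <= height y])).
  by move=> y; split=> [[[]]|[]].
apply: semialgebraicI; first apply: semialgebraicI.
- apply: semialgebraic_le; last exact: polynomial_cst.
  exact: polynomial_dot.
- apply: semialgebraic_le; last exact: polynomial_cst.
  exact/polynomial_height/polynomial_map_id.
apply: semialgebraic_forall; apply: semialgebraic_imply.
  by apply: semialgebraic_preimage => //; exact: semialgebraic_minorant.
apply: semialgebraic_le; last exact: polynomial_height.
apply: polynomialD; last exact: polynomial_height.
by apply: polynomial_dot; exact: polynomial_map_lsubmx.
Qed.

Lemma closed_envelope : closed envelope.
Proof.
have pl a b := @polynomial_map_lsubmx R _ a b _ (@polynomial_map_id R (a + b)).
rewrite (_ : envelope =
  [set y | dot (lsubmx y) (lsubmx y) <= 1] `&` [set y | height y <= C] `&`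
  \bigcap_(l in minorant)
    [set y | dot (lsubmx l) (lsubmx y) + height l <= height y]); last first.
  by apply/seteqP; split=> y [] => [? ? ?|[? ?] ?]; split.
apply: closedI; first apply: closedI.
- apply: closed_polynomial_le; last exact: polynomial_cst.
  exact: polynomial_dot.
- apply: closed_polynomial_le; last exact: polynomial_cst.
  exact/polynomial_height/polynomial_map_id.
apply: closed_bigI => l _; apply: closed_polynomial_le.
  apply: polynomialD; last exact: polynomial_cst.
  by apply: polynomial_dot => //; exact: polynomial_map_cst.
exact/polynomial_height/polynomial_map_id.
Qed.

(** This minorant bounds the heights in [envelope] from below, as compactness requires. *)
Lemma minorant_cst : minorant (row_mx 0 (- C)%:M).
Proof.
move=> x; rewrite /height row_mxKl row_mxKr dot0l add0r mxE eqxx mulr1n.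
rewrite mulNr mulNr -mulrA -exprS lerNl.
by apply: le_trans (fC x); rewrite -normrN ler_norm.
Qed.

Lemma compact_envelope : compact envelope.
Proof.
apply: subclosed_compact closed_envelope (@compact_box R _ (1 + C)) _.
move=> y [sy tC /(_ _ minorant_cst)].
rewrite /height row_mxKl row_mxKr dot0l add0r mxE eqxx mulr1n => Ct i.
have C0 := C_ge0.
rewrite -[y]hsubmxK mxE; case: fintype.splitP => j _.
  have sj : (lsubmx y) ord0 j ^+ 2 <= 1.
    by rewrite (le_trans _ sy)// sqr_coord_le_dot.
  apply: (@le_trans _ _ 1); last by rewrite lerDl.
  by rewrite -(@ler_pXn2r _ 2)// ?nnegrE// expr1n real_normK ?num_real.
rewrite (ord1 j) ler_norml; apply/andP; split.
  by apply: le_trans Ct; rewrite lerN2 lerDr.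
by apply: le_trans tC _; rewrite lerDr.
Qed.

Lemma lsubmx_lin (a b : R) (y z : 'rV[R]_(n + 1 + 1)) :
  lsubmx (a *: y + b *: z) = a *: lsubmx y + b *: lsubmx z.
Proof. by rewrite linearD !linearZ. Qed.

Lemma height_lin (a b : R) (y z : 'rV[R]_(n + 1 + 1)) :
  height (a *: y + b *: z) = a * height y + b * height z.
Proof. by rewrite /height linearD !linearZ !mxE. Qed.

Lemma convex_envelope : convex_set envelope.
Proof.
move=> y z p /set_mem[sy ty ly] /set_mem[sz tz lz]; apply/mem_set.
suff H (a b : R) : 0 <= a -> 0 <= b -> a + b = 1 ->
    envelope (a *: (y : 'rV[R]_(n + 1 + 1)) + b *: (z : 'rV[R]_(n + 1 + 1))).
  by apply: H => //; [exact: unstable.onem_ge0|exact: unstable.add_onemK].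
move=> a0 b0 ab; have -> : b = 1 - a by rewrite -ab addrAC subrr add0r.
have {}b0 : 0 <= 1 - a by rewrite -ab addrAC subrr add0r.
split.
(* [|y - z|^2 >= 0] bounds the cross term [yz] by [1], which gives convexity of the unit ball. *)
- have := dot_ge0
    (lsubmx (y : 'rV[R]_(n + 1 + 1)) - lsubmx (z : 'rV[R]_(n + 1 + 1))).
  rewrite lsubmx_lin !dotDl !dotDr !dotNl !dotNr !dotZl !dotZr.
  rewrite (dotC (lsubmx z) (lsubmx y)).
  move: sy sz; set yy := dot (lsubmx y) (lsubmx y).
  set zz := dot (lsubmx z) (lsubmx z).
  set yz := dot _ _ => sy sz yz_le.
  have yz1 : yz <= 1 by lra.
  have aa : 0 <= a * (1 - a) by rewrite mulr_ge0.
  have a2 := sqr_ge0 a; have b2 := sqr_ge0 (1 - a).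
  nra.
- by rewrite height_lin; nra.
move=> l ml; rewrite lsubmx_lin height_lin dotDr !dotZr.
by have := ly l ml; have := lz l ml; nra.
Qed.

Lemma envelope_stereo x t : f x <= t * sqnorm1 x ^+ K.+1 -> t <= C ->
  envelope (row_mx ((sqnorm1 x)^-1 *: stereo x) t%:M).
Proof.
have q0 := sqnorm1_gt0 x; move=> ft tC; split.
- rewrite row_mxKl dotZl dotZr dot_stereo_sqr mulrA -expr2 -exprMn.
  by rewrite mulVf ?gt_eqF// expr1n.
- by rewrite /height row_mxKr mxE eqxx mulr1n.
move=> l /(_ x); rewrite {3}/height row_mxKl row_mxKr mxE eqxx mulr1n dotZr => lx.
have := le_trans lx ft; rewrite exprS mulrA ler_pM2r ?exprn_gt0//.
have qV0 : 0 <= (sqnorm1 x)^-1 by rewrite invr_ge0 ltW.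
move=> /(ler_wpM2r qV0).
by rewrite mulrDl !mulfK ?gt_eqF// [_ * dot _ _]mulrC.
Qed.

(** Sphere points are exposed in the ball: a steep affine function with value [al] at the point of
    [x0] drops to [- C] or lower away from it, while near [x0] lower semicontinuity leaves room
    above [al]. *)
Lemma separating_minorant x0 t : t * sqnorm1 x0 ^+ K.+1 < f x0 ->
  exists2 l, minorant l &
    t < dot (lsubmx l) ((sqnorm1 x0)^-1 *: stereo x0) + height l.
Proof.
have q0 := sqnorm1_gt0 x0; have qK0 : 0 < sqnorm1 x0 ^+ K.+1 by rewrite exprn_gt0.
rewrite -ltr_pdivlMr// => te.
(* The value of the future minorant at the sphere point of [x0]. *)
pose al := (t + f x0 / sqnorm1 x0 ^+ K.+1) / 2.
have [tal ale] : t < al /\ al * sqnorm1 x0 ^+ K.+1 < f x0.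
  by split; rewrite -?ltr_pdivlMr//; rewrite /al; lra.
(* Lower semicontinuity compares [f] with constants only, so [c] separates it near [x0] from the
   continuous function [al * sqnorm1 x ^+ K.+1]. *)
pose c := (al * sqnorm1 x0 ^+ K.+1 + f x0) / 2.
have [alc cf] : al * sqnorm1 x0 ^+ K.+1 < c /\ c < f x0 by rewrite /c; split; lra.
have near_al : nbhs x0 [set x | al * sqnorm1 x ^+ K.+1 < c].
  have pq : polynomial_fun (fun x : 'rV[R]_n => al * sqnorm1 x ^+ K.+1).
    apply: polynomialM; first exact: polynomial_cst.
    by apply: polynomialX; apply: polynomial_sqnorm1; exact: polynomial_map_id.
  exact: (cvgr_lt _ (continuous_polynomial pq (x := x0)) _ alc).
have [V x0V fV] := @lf x0 c cf.
have [d /= d0 dball] := iffLR (nbhs_ballP _ _) (filterI near_al x0V).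
have near_x0 x : dot (x - x0) (x - x0) < d ^+ 2 -> al * sqnorm1 x ^+ K.+1 < f x.
  move=> xd; have [|/= lt1 /fV] := dball x; last first.
    by rewrite /= lte_fin; exact: lt_trans.
  split=> // i j; rewrite (ord1 i) -ball_normE /ball_ /= distrC.
  have := le_lt_trans (sqr_coord_le_dot (x - x0) j) xd.
  rewrite !mxE -[X in X < _]real_normK ?num_real// ltr_pXn2r ?nnegrE ?(ltW d0)//.
(* At distance at least [d] from [x0], the penalty [2 * (M / sqnorm1 x0) * D] has to reach
   [(|al| + C) * sqnorm1 x]; the middle factor comes from the bound [qx] below. *)
pose M := sqnorm1 x0 * (sqnorm1 x0 / d ^+ 2 + 1) * (`|al| + C).
have d20 : 0 < d ^+ 2 by rewrite exprn_gt0.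
have C0 := C_ge0; have al0 := normr_ge0 al.
have M0 : 0 <= M.
  apply: mulr_ge0; last exact: addr_ge0.
  apply: mulr_ge0; first exact: ltW.
  by apply: addr_ge0 => //; apply: divr_ge0; exact: ltW.
(* The affine function [al - M * (1 - <sigma, s>)] with [sigma = stereo x0 / sqnorm1 x0]. *)
exists (row_mx ((M / sqnorm1 x0) *: stereo x0) (al - M)%:M); last first.
  rewrite /height row_mxKl row_mxKr mxE eqxx mulr1n dotZl dotZr dot_stereo_sqr.
  rewrite mulrA -[M / _ / _]mulrA -invfM -expr2.
  by rewrite divfK ?expf_neq0 ?gt_eqF// addrC subrK.
move=> x; rewrite /height row_mxKl row_mxKr mxE eqxx mulr1n dotZl dotC dot_stereo.
set D := dot _ _.
have -> : M / sqnorm1 x0 * (sqnorm1 x * sqnorm1 x0 - 2 * D) + (al - M) * sqnorm1 x =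
    al * sqnorm1 x - 2 * (M / sqnorm1 x0) * D.
  by field; rewrite gt_eqF.
have qx0 := sqnorm1_gt0 x; have D0 : 0 <= D := dot_ge0 _.
have Mq0 : 0 <= M / sqnorm1 x0 by rewrite divr_ge0// ltW.
(* Near [x0] the penalty is simply dropped; farther away it brings the minorant down to the lower
   bound [- C]. *)
have [lt_D|le_D] := ltP D (d ^+ 2).
  apply: le_trans (ltW (near_x0 x lt_D)).
  rewrite exprS [leRHS]mulrA ler_wpM2r ?exprn_ge0 ?(ltW qx0)// gerBl.
  by rewrite mulr_ge0// mulr_ge0.
have fx : - (C * sqnorm1 x ^+ K.+1) <= f x.
  by rewrite lerNl (le_trans _ (fC x))// -normrN ler_norm.
apply: le_trans fx; rewrite exprS [C * _]mulrA -[leRHS]mulNr.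
rewrite ler_wpM2r ?exprn_ge0 ?(ltW qx0)//.
have -> : M / sqnorm1 x0 = (sqnorm1 x0 / d ^+ 2 + 1) * (`|al| + C).
  by rewrite /M; field; rewrite !gt_eqF.
have qx : sqnorm1 x <= 2 * ((sqnorm1 x0 / d ^+ 2 + 1) * D).
  apply: le_trans (sqnorm1_le x x0) _.
  rewrite -mulrDr ler_pM2l// mulrDl mul1r lerD2r.
  by rewrite -mulrA ler_peMr ?(ltW q0)// mulrC ler_pdivlMr// mul1r.
rewrite lerBlDr -lerBlDl opprK -mulrDl.
apply: (@le_trans _ _ ((`|al| + C) * sqnorm1 x)).
  by rewrite ler_wpM2r ?(ltW qx0)// lerD2r ler_norm.
apply: le_trans (ler_wpM2l _ qx) _; first by rewrite addr_ge0.
by rewrite le_eqVlt; apply/orP; left; apply/eqP; ring.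
Qed.

(** A point lying too low over the sphere would violate the constraint of a separating minorant. *)
Lemma envelope_height_ge x y : envelope y -> sqnorm1 x *: lsubmx y = stereo x ->
  f x <= sqnorm1 x ^+ K.+1 * height y.
Proof.
move=> [_ _ ly] yx; rewrite leNgt mulrC; apply/negP => /separating_minorant[l /ly].
have -> : lsubmx y = (sqnorm1 x)^-1 *: stereo x.
  by rewrite -yx scalerA mulVf ?scale1r// gt_eqF// sqnorm1_gt0.
by rewrite leNgt => /negP.
Qed.

Lemma optimistic_value_envelope : exists P Q : mpoly.mpoly (n + (n + 1 + 1)) R,
  convex_compact_problem Q envelope /\
  optimistic_value P Q envelope = EFin \o f.
Proof.
have pl := @polynomial_map_lsubmx R _ n (n + 1 + 1) _ (@polynomial_map_id R _).
have pr := @polynomial_map_rsubmx R _ n (n + 1 + 1) _ (@polynomial_map_id R _).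
have [Q QE] : polynomial_fun (fun z : 'rV[R]_(n + (n + 1 + 1)) =>
    - dot (stereo (lsubmx z)) (lsubmx (rsubmx z))).
  apply: polynomialN; apply: polynomial_dot; first exact: polynomial_map_stereo.
  exact: polynomial_map_lsubmx.
have [P PE] : polynomial_fun (fun z : 'rV[R]_(n + (n + 1 + 1)) =>
    sqnorm1 (lsubmx z) ^+ K.+1 * height (rsubmx z)).
  apply: polynomialM; last exact: polynomial_height.
  by apply: polynomialX; exact: polynomial_sqnorm1.
have {}QE x y : peval2 Q x y = - dot (stereo x) (lsubmx y).
  by rewrite /peval2 -QE row_mxKl row_mxKr.
have {}PE x y : peval2 P x y = sqnorm1 x ^+ K.+1 * height y.
  by rewrite /peval2 -PE row_mxKl row_mxKr.
(* The lowest point of the envelope over the sphere point of [x]: it witnesses nonemptiness, solves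
   the lower level, and attains the optimistic value. *)
pose y0 x := row_mx ((sqnorm1 x)^-1 *: stereo x) (f x / sqnorm1 x ^+ K.+1)%:M.
have qK0 (x : 'rV[R]_n) : 0 < sqnorm1 x ^+ K.+1 by rewrite exprn_gt0// sqnorm1_gt0.
have y0E x : envelope (y0 x).
  apply: envelope_stereo; first by rewrite divfK// gt_eqF.
  by rewrite ler_pdivrMr// (le_trans (ler_norm _)).
have Qy0 x : peval2 Q x (y0 x) = - sqnorm1 x.
  rewrite QE /y0 row_mxKl dotZr dot_stereo_sqr expr2 mulKf// gt_eqF//.
  exact: sqnorm1_gt0.
exists P, Q; split.
  split.
  (* [Q] is linear in [y], so the convexity inequality is an equality. *)
  - move=> x p y z _ _; rewrite !QE.
    rewrite [lsubmx _]lsubmx_lin dotDr !dotZr opprD -!mulrN; exact: lexx.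
  - by exists (y0 0); exact: y0E.
  - exact: compact_envelope.
  - exact: convex_envelope.
  - exact: semialgebraic_envelope.
apply/funext => x /=.
have y0T : Theta Q envelope x (y0 x).
  split=> // y [sy _ _]; rewrite Qy0 QE lerN2; exact: dot_stereo_le.
rewrite (optimistic_valueE y0T).
  by rewrite PE /y0 /height row_mxKr mxE eqxx mulr1n mulrC divfK// gt_eqF.
move=> y [Ey ymin]; rewrite !PE {1}/y0 {1}/height row_mxKr mxE eqxx mulr1n.
rewrite [X in X <= _]mulrC divfK ?gt_eqF//; apply: envelope_height_ge => //.
(* Comparison with [y0 x] in the lower level pins the first component of [y] to the sphere point of
   [x]. *)
have := ymin _ (y0E x); rewrite Qy0 QE lerN2; apply: stereo_maximal.
by have [] := Ey.
Qed.

End Construction.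

(** * The optimistic and pessimistic characterizations *)

Section Characterization.
Variables (R : realType) (n : nat).
Implicit Types (f : 'rV[R]_n -> R) (h : 'rV[R]_n -> \bar R).

Lemma SA_EFin f : SA R n (EFin \o f) <-> semialgebraic_fun f.
Proof.
have graphE (z : 'rV[R]_(n + 1)) : finite_graph (EFin \o f) z <-> graph f z.
  by rewrite /finite_graph /graph /=; split=> [[]|->].
split=> [[_ _ _]|sf]; first exact: eq_semialgebraic.
split.
- apply: eq_semialgebraic (semialgebraicC (@semialgebraic_set0 R n)) => x.
  by split=> // _ [].
- by apply: eq_semialgebraic (@semialgebraic_set0 R n) => x; split.
- by apply: eq_semialgebraic (@semialgebraic_set0 R n) => x; split.
- by apply: eq_semialgebraic sf => z; split=> /graphE.
Qed.

Lemma C_optim_ccE : C_optim_cc R n = SA R n `&` LSC R n `&` CB R n.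
Proof.
apply/seteqP; split=> h.
  move=> [m [P [Q [Y [[_ Y0 cY _ sY] <-]]]]]; split; last exact: optimistic_value_CB.
  by split; [exact: optimistic_value_SA|exact: optimistic_value_lsc].
move=> [[]] /[swap] lh + [f hf bf]; rewrite {}hf in lh * => /SA_EFin sf.
have [N fN] := semialgebraic_growth sf bf.
have [P [Q PQ]] : exists P Q,
    convex_compact_problem Q (envelope f (N.+1%:R ^+ N) N) /\
    optimistic_value P Q (envelope f (N.+1%:R ^+ N) N) = EFin \o f.
  (* With [q = sqnorm1 x >= 1], the growth bound gives [(N + 1 + |x|^2) ^ N <= ((N + 1) * q) ^ N <=
     (N + 1) ^ N * q ^ (N + 1)]. *)
  apply: optimistic_value_envelope => // x; apply: le_trans (fN x) _.
  have q1 := sqnorm1_ge1 x; have N1 : 1 <= N.+1%:R :> R by rewrite ler1n.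
  apply: (@le_trans _ _ ((N.+1%:R * sqnorm1 x) ^+ N)).
    rewrite lerXn2r ?nnegrE ?addr_ge0 ?mulr_ge0 ?dot_ge0 ?(ltW (sqnorm1_gt0 x))//.
    by rewrite mulrDr mulr1 lerD2l ler_peMl ?dot_ge0.
  by rewrite exprMn ler_wpM2l ?exprn_ge0// ler_weXn2l.
by exists (n + 1 + 1)%N, P, Q, (envelope f (N.+1%:R ^+ N) N).
Qed.

Lemma pessimistic_valueN m (P Q : mpoly.mpoly (n + m) R) Y x :
  pessimistic_value P Q Y x = (- optimistic_value (- P)%R Q Y x)%E.
Proof.
rewrite /pessimistic_value /optimistic_value ereal_supEN; congr (- ereal_inf _)%E.
by rewrite image_comp; apply: eq_imagel => y _; rewrite /= /peval2 pevalN.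
Qed.

(** The sign change affects [P] alone, so the lower-level problem and its solution sets stay the
    same. *)
Lemma C_pessim_ccN h : C_pessim_cc R n h <-> C_optim_cc R n (fun x => - h x)%E.
Proof.
split=> -[m [P [Q [Y [pQ PQ]]]]]; exists m, (- P), Q, Y; split=> //;
  apply/funext => x.
  by rewrite -PQ pessimistic_valueN oppeK.
by rewrite pessimistic_valueN opprK PQ oppeK.
Qed.

Lemma SAN h : SA R n h -> SA R n (fun x => - h x)%E.
Proof.
move=> [sfin spoo snoo sgr]; split.
- by apply: eq_semialgebraic sfin => x /=; rewrite fin_numN.
- by apply: eq_semialgebraic snoo => x /=; rewrite (eqe_oppLRP _ _).
- by apply: eq_semialgebraic spoo => x /=; rewrite (eqe_oppLRP _ _).
(* Negation reflects the finite graph in its last coordinate, a polynomial change of variables. *)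
pose u (z : 'rV[R]_(n + 1)) := row_mx (lsubmx z) ((- rsubmx z ord0 ord0)%:M : 'rV_1).
have pu : polynomial_map u.
  have id := @polynomial_map_id R (n + 1).
  apply: polynomial_map_row_mx; first exact: polynomial_map_lsubmx.
  by apply/polynomial_map_scalar/polynomialN; exact: polynomial_map_rsubmx.
apply: eq_semialgebraic (semialgebraic_preimage pu sgr) => z.
rewrite /finite_graph /u /= row_mxKl row_mxKr mxE eqxx mulr1n EFinN.
by split=> [->|<-]; rewrite oppeK.
Qed.

Lemma CBN h : CB R n h -> CB R n (fun x => - h x)%E.
Proof.
move=> [f -> bf]; exists (fun x => - f x) => // K /bf[M [Mr fM]].
by exists M; split=> // M' /fM H x Kx /=; rewrite normrN; exact: H.
Qed.

Lemma LSCN h : LSC R n (fun x => - h x)%E <-> USC R n h.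
Proof.
split=> sh x a hxa.
  have [|V xV hV] := sh x (- a); first by rewrite EFinN lteN2.
  by exists V => // y /hV; rewrite EFinN lteN2.
have [|V xV hV] := sh x (- a); first by rewrite EFinN lteNr.
by exists V => // y /hV; rewrite EFinN lteNr.
Qed.

Lemma C_pessim_ccE : C_pessim_cc R n = SA R n `&` USC R n `&` CB R n.
Proof.
apply/seteqP; split=> h.
  move=> /C_pessim_ccN; rewrite C_optim_ccE => -[[/SAN sh /LSCN lh] /CBN bh].
  have hE : (fun x => - - h x)%E = h by apply/funext => x; rewrite oppeK.
  by rewrite hE in sh bh.
move=> [[/SAN sh /LSCN lh] /CBN bh].
by apply/C_pessim_ccN; rewrite C_optim_ccE.
Qed.

End Characterization.

Theorem theorem2p21 (R : realType) (n : nat) :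
  [/\ forall f : 'rV[R]_n -> R,
        semialgebraic_fun f -> lower_semicontinuous (EFin \o f) ->
        bounded_on_compacts f -> C_optim_cc R n (EFin \o f),
      forall f : 'rV[R]_n -> R,
        semialgebraic_fun f -> upper_semicontinuous (EFin \o f) ->
        bounded_on_compacts f -> C_pessim_cc R n (EFin \o f),
      C_optim_cc R n = SA R n `&` LSC R n `&` CB R n &
      C_pessim_cc R n = SA R n `&` USC R n `&` CB R n].
Proof.
split.
- move=> f sf lf bf; rewrite C_optim_ccE; split; last by exists f.
  by split=> //; apply/SA_EFin.
- move=> f sf uf bf; rewrite C_pessim_ccE; split; last by exists f.
  by split=> //; apply/SA_EFin.
- exact: C_optim_ccE.
- exact: C_pessim_ccE.
Qed.
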